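(* For a ring $R$, the following conditions are equivalent: (1) There exists $n\in\mathbb{N}$ such that $R$ is an $n$-torsion clean abelian ring. (2) (a) $\mathrm{char}(R)$ is finite; (b) the Jacobson radical $J(R)$ is nil of bounded index; (c) idempotents lift uniquely modulo $J(R)$; (d) $R/J(R)$ is a subdirect product of finite fields $F_i$, $i\in I$ for some index set $I$, such that $\mathrm{LCM}(|F_i|-1\mid i\in I)$ exists. (3) $R$ is an abelian clean ring whose unit group $U(R)$ has finite exponent.
   Context: All rings are associative with identity. $U(R)$ is the unit group, $J(R)$ the Jacobson radical, $\mathrm{char}(R):=|1\cdot\mathbb{Z}|$. A ring is clean if every element is a sum of an idempotent and a unit. A ring $R$ is $n$-torsion clean if every $r\in R$ can be written $r=e+u$ with $e^2=e$, $u\in U(R)$, $u^n=1$, and $n$ is the smallest natural number with this property. A ring is abelian if all its idempotents are central. An ideal $I$ is nil of bounded index if there is $k$ with $r^k=0$ for all $r\in I$. Idempotents lift modulo an ideal $J$ if for every $a\in R$ with $a^2-a\in J$ there is an idempotent $e\in R$ with $e-a\in J$; they lift uniquely if such $e$ is uniquely determined by $a$. $\mathrm{LCM}(|F_i|-1\mid i\in I)$ exists means the set $\{|F_i|-1\mid i\in I\}$ has a least common multiple in $\mathbb{N}$. *)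

(* Defs.v *)
From HB Require Import structures.
From mathcomp Require Import all_boot all_order all_algebra.
Set Implicit Arguments. Unset Strict Implicit. Unset Printing Implicit Defensive.
Import GRing.Theory.
Local Open Scope ring_scope.

Section Defs.
Variable R : unitRingType.

Definition idempotent (e : R) : Prop := e * e = e.

Definition clean_ring : Prop :=
  forall r : R, exists e u : R, idempotent e /\ u \is a GRing.unit /\ r = e + u.

Definition torsion_clean_with (n : nat) : Prop :=
  forall r : R, exists e u : R,
    [/\ idempotent e, u \is a GRing.unit, u ^+ n = 1 & r = e + u].

Definition n_torsion_clean (n : nat) : Prop :=
  (0 < n)%N /\ torsion_clean_with n /\
  (forall m : nat, (0 < m)%N -> torsion_clean_with m -> (n <= m)%N).

Definition abelian_ring : Prop :=
  forall e : R, idempotent e -> forall r : R, e * r = r * e.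

(* char(R) = |1 . Z| is finite *)
Definition finite_char : Prop := exists m : nat, (0 < m)%N /\ (m%:R : R) = 0.

Definition left_ideal (I : R -> Prop) : Prop :=
  [/\ I 0, (forall x y, I x -> I y -> I (x - y)) & (forall r x, I x -> I (r * x))].

Definition maximal_left_ideal (M : R -> Prop) : Prop :=
  [/\ left_ideal M, ~ M 1 &
      forall N : R -> Prop, left_ideal N -> (forall x, M x -> N x) ->
        (forall x, N x <-> M x) \/ N 1].

Definition jacobson (x : R) : Prop :=
  forall M : R -> Prop, maximal_left_ideal M -> M x.

Definition nil_bounded_index (I : R -> Prop) : Prop :=
  exists k : nat, forall r, I r -> r ^+ k = 0.

Definition idempotents_lift_uniquely (I : R -> Prop) : Prop :=
  forall a : R, I (a * a - a) ->
    exists e : R, (idempotent e /\ I (e - a)) /\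
      forall e' : R, idempotent e' -> I (e' - a) -> e' = e.

(* R/J is a subdirect product of finite fields F_i (i in I) such that
   LCM(|F_i| - 1 | i in I) exists in N. The quotient R/J is given by any
   ring Q with a surjective ring morphism pi : R -> Q whose kernel is J. *)
Definition quotient_subdirect_finite_fields_lcm (J : R -> Prop) : Prop :=
  exists (Q : pzRingType) (pi : {rmorphism R -> Q}),
    (forall y : Q, exists x : R, pi x = y) /\
    (forall x : R, pi x = 0 <-> J x) /\
    exists (I : Type) (F : I -> finFieldType) (f : forall i, {rmorphism Q -> F i}),
      (forall i (y : F i), exists q : Q, f i q = y) /\
      (forall q1 q2 : Q, (forall i, f i q1 = f i q2) -> q1 = q2) /\
      exists L : nat, [/\ (0 < L)%N,
        forall i, (#|F i| - 1 %| L)%N &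
        forall m : nat, (forall i, (#|F i| - 1 %| m)%N) -> (L %| m)%N].

Definition units_finite_exponent : Prop :=
  exists m : nat, (0 < m)%N /\ forall u : R, u \is a GRing.unit -> u ^+ m = 1.

End Defs.

(* Main.v *)
From HB Require Import structures.
From mathcomp Require Import all_boot all_order all_algebra finfield.
From mathcomp Require Import boolp classical_sets.
Require Import Defs.

(** In an abelian ring, a decomposition r = e + u with u^n = 1 splits R into two
    corners on which r^n = 1 and (r - 1)^n = 1 respectively, so that
    (r^n - 1)((r - 1)^n - 1) = 0 for every r. Taking r = 3 bounds the
    characteristic, and a pigeonhole argument on the powers of X modulo this
    monic polynomial and the characteristic gives a single k > 0 such that every
    r^k is a (central) idempotent. It follows that J(R) is the set of nilpotent
    elements, that maximal left ideals are two-sided, and that their quotients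
    are skew fields of exponent k, which are finite fields by Jacobson's
    commutativity argument and Wedderburn's theorem. Conversely, if R/J(R)
    embeds in a product of finite fields F_i with |F_i| - 1 dividing L, then
    r^(L+1) - r lies in J(R); the idempotent e lifting r^L makes r - (1 - e) a
    unit, and the binomial formula bounds the exponent of 1 + J(R). *)

Set Implicit Arguments.
Unset Strict Implicit.
Unset Printing Implicit Defensive.

Import GRing.Theory.
Local Open Scope ring_scope.

(** * Skew fields of finite exponent *)

(** Invertibility of nonzero elements is implicit: [x ^+ k = 1] with [0 < k] makes [x ^+ k.-1] an
    inverse of [x]. *)
Definition torsion_skew_field (D : unitRingType) (k : nat) : Prop :=
  (0 < k)%N /\ forall x : D, x != 0 -> x ^+ k = 1.

Section TorsionSkewField.
Variables (D : unitRingType) (k : nat).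
Hypothesis Dk : torsion_skew_field D k.

Lemma torsion_unit (x : D) : x != 0 -> x \is a GRing.unit.
Proof. by case: Dk => k0 /[apply] xk; rewrite -(unitrX_pos _ k0) xk unitr1. Qed.

Lemma torsion_domain (x y : D) : x * y = 0 -> (x == 0) || (y == 0).
Proof.
move=> xy0; have [//|x0] /= := eqVneq x 0.
by rewrite -(mulKr (torsion_unit x0) y) xy0 mulr0 eqxx.
Qed.

Lemma torsion_expr_mod (x : D) i : x != 0 -> x ^+ (i %% k) = x ^+ i.
Proof.
move=> /(proj2 Dk) xk; rewrite [in RHS](divn_eq i k) exprD mulnC.
by rewrite exprM xk expr1n mul1r.
Qed.

Lemma torsion_finite_char : exists2 c, (0 < c)%N & c%:R = 0 :> D.
Proof.
case: Dk => k0 torD; have [D2|/torD D2] := eqVneq (2%:R : D) 0; first by exists 2.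
(* A nonzero 2 satisfies [2 ^+ k = 1], so this integer vanishes in [D]. *)
exists (2 ^ k - 1)%N; first by rewrite subn_gt0 -[1%N](expn0 2) ltn_exp2l.
by rewrite natrB ?expn_gt0 // natrX D2 subrr.
Qed.

Section FiniteSubring.
Variable s : seq D.
Hypothesis s_subring : subring_closed (mem s).

(** The closure proof is a parameter of the type so that the ring instances attached to it can use
    that proof. *)
Definition fsubring of subring_closed (mem s) := seq_sub s.
Local Notation S := (fsubring s_subring).

HB.instance Definition _ := SubFinite.on S.

(** The inverse of a nonzero [y] is the power [y ^+ k.-1], and [0^-1] is [0] by convention. *)
Lemma fsubring_divring_closed : divring_closed (mem s).
Proof.
case: s_subring => s1 sB sM; split=> // x y xs ys.
have sX n z : z \in s -> z ^+ n \in s.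
  by move=> zs; elim: n => [|n IH]; rewrite ?expr0 // exprS; apply: sM.
apply: sM => //; have [->|y0] := eqVneq y 0.
  by rewrite invr0 -(subrr 1); apply: sB.
suff -> : y^-1 = y ^+ k.-1 by apply: sX.
case: Dk => k0 /(_ _ y0); rewrite -(prednK k0) exprS /= => yk.
by rewrite -[LHS]mulr1 -yk mulKr // torsion_unit.
Qed.

HB.instance Definition _ :=
  GRing.SubChoice_isSubUnitRing.Build D _ S fsubring_divring_closed.

Lemma fsubring_domain : GRing.integral_domain_axiom S.
Proof.
move=> x y /(congr1 val); rewrite rmorphM rmorph0 => /torsion_domain.
by rewrite -!(inj_eq val_inj) rmorph0.
Qed.

(** A finite domain is a field by Wedderburn's theorem, which [FinDomainFieldType] packages; [iota]
    is the inclusion. *)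
Lemma finite_subring_field :
  exists (K : finFieldType) (iota : {rmorphism K -> D}),
    forall x, x \in s <-> exists y, iota y = x.
Proof.
exists (FinDomainFieldType fsubring_domain).
pose f : FinDomainFieldType fsubring_domain -> D := (val : S -> D).
have fB : zmod_morphism f by move=> x y; exact: rmorphB.
have fM : monoid_morphism f by split => [|x y]; [exact: rmorph1|exact: rmorphM].
pose mB := GRing.isZmodMorphism.Build _ _ f fB.
pose mM := GRing.isMonoidMorphism.Build _ _ f fM.
pose F : {rmorphism _ -> _} := HB.pack f mB mM.
exists F => x; split=> [xs|[y <-]]; last exact: ssvalP.
by exists (SeqSub xs).
Qed.

End FiniteSubring.
End TorsionSkewField.

(** * Finite additive spans, and eigenvectors for a noncommuting element *)

Lemma mulrn_modn (V : pzRingType) c (x : V) n :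
  c%:R = 0 :> V -> x *+ (n %% c) = x *+ n.
Proof.
move=> c0; rewrite [in RHS](divn_eq n c) mulrnDr mulnC mulrnA -(mulr_natr x c) c0.
by rewrite mulr0 mul0rn add0r.
Qed.

(** The additive span of [G] is finite because coefficients matter only modulo [c], and it is closed
    under products because [G] is. The last clause is induction over sums of generators. *)
Lemma finite_subring_span (D : pzRingType) c (G : seq D) :
    (0 < c)%N -> c%:R = 0 :> D -> 1 \in G -> {in G &, forall x y, x * y \in G} ->
  exists2 s : seq D, subring_closed (mem s) /\ {subset G <= s} &
    forall P : D -> Prop, P 0 -> (forall x y, P x -> P y -> P (x + y)) ->
      {in G, forall x, P x} -> {in s, forall x, P x}.
Proof.
case: c => // c _ c0 G1 GM.
pose val_ (v : {ffun 'I_(size G) -> 'I_c.+1}) : D := \sum_(i < size G) G`_i *+ v i.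
pose s := [seq val_ v | v : {ffun 'I_(size G) -> 'I_c.+1}].
have sP (m : 'I_(size G) -> nat) : \sum_(i < size G) G`_i *+ m i \in s.
  apply/mapP; exists [ffun i => inZp (m i)]; first by rewrite mem_enum.
  by apply: eq_bigr => i _; rewrite ffunE /= mulrn_modn.
have s0 : 0 \in s.
  by have := sP (fun=> 0%N); rewrite big1.
have sD : {in s &, forall x y, x + y \in s}.
  move=> _ _ /mapP[v _ ->] /mapP[w _ ->]; rewrite -big_split /=.
  by under eq_bigr do rewrite -mulrnDr; exact: sP.
have sMn x n : x \in s -> x *+ n \in s.
  by move=> xs; elim: n => [|n IH]; rewrite ?mulr0n // mulrS; apply: sD.
have sN x : x \in s -> - x \in s.
  (* After the case analysis the characteristic bound is [c.+1], so [c] stands for -1. *)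
  move=> xs; suff -> : - x = x *+ c by apply: sMn.
  by apply/eqP; rewrite eq_sym -addr_eq0 -mulrSr -mulr_natr c0 mulr0.
have Gs : {subset G <= s}.
  move=> x xG; have ix : (index x G < size G)%N by rewrite index_mem.
  have := sP (fun i => (i == Ordinal ix)); rewrite (bigD1 (Ordinal ix)) //= eqxx.
  by rewrite big1 ?addr0 ?nth_index // => i /negbTE ->.
have ind (P : D -> Prop) : P 0 -> (forall x y, P x -> P y -> P (x + y)) ->
      {in G, forall x, P x} -> {in s, forall x, P x}.
  move=> P0 PD PG _ /mapP[v _ ->]; rewrite /val_.
  elim/big_ind: _ => // i _; elim: (nat_of_ord (v i)) => [|n IH]; rewrite ?mulr0n //.
  by rewrite mulrS; apply: PD => //; apply/PG/mem_nth.
exists s => //; split=> //; split=> [|x y xs ys|x y xs ys].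
- exact: Gs.
- by apply: sD => //; apply: sN.
apply: (ind (fun x => x * y \in s)) xs => [|u v us vs|u uG].
- by rewrite mul0r.
- by rewrite mulrDl; apply: sD.
apply: (ind (fun y => u * y \in s)) ys => [|v w vs ws|v vG].
- by rewrite mulr0.
- by rewrite mulrDr; apply: sD.
- by apply/Gs/GM.
Qed.

(* {poly K} acts on D, scalars on the left and 'X by right multiplication by f b.
   Since 'X^#|K| - 'X acts as 0 and is the product of all 'X - c, some factor
   with c != b has a nonzero kernel. *)
Lemma bimodule_eigenvector (D : pzRingType) (K : finFieldType)
    (f : {rmorphism K -> D}) (b : K) (x : D) :
  x * f b != f b * x -> exists w c, [/\ w != 0, c != b & w * f b = f c * w].
Proof.
move=> nab.
pose act (p : {poly K}) y := \sum_(j < size p) f p`_j * y * f b ^+ j.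
have actE n (p : {poly K}) y : (size p <= n)%N ->
    act p y = \sum_(j < n) f p`_j * y * f b ^+ j.
  move=> pn; rewrite /act (big_ord_widen n (fun j => f p`_j * y * f b ^+ j)) //.
  rewrite big_mkcond; apply: eq_bigr => i _; case: ltnP => // ip.
  by rewrite nth_default // rmorph0 !mul0r.
have actM c p y : act (('X - c%:P) * p) y = act p y * f b - f c * act p y.
  have sz1 : (size (('X - c%:P) * p)%R <= (size p).+1)%N.
    by rewrite (leq_trans (size_polyMleq _ _)) // size_XsubC.
  rewrite (actE _ _ _ sz1) (actE (size p).+1 p) //.
  under eq_bigr => j _ do rewrite mulrBl coefB coefCM rmorphB !mulrBl.
  rewrite sumrB; congr (_ - _); last first.
    by rewrite mulr_sumr; apply: eq_bigr => j _; rewrite rmorphM !mulrA.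
  rewrite big_ord_recl coefXM eqxx rmorph0 !mul0r add0r.
  rewrite big_ord_recr /= [p`_(size p)]nth_default // rmorph0 !mul0r addr0.
  rewrite mulr_suml; apply: eq_bigr => j _.
  by rewrite coefXM /= exprSr !mulrA.
have act1 y : act 1 y = y.
  by rewrite (actE 1%N) ?size_poly1 // big_ord1 coefC /= rmorph1 mul1r mulr1.
(* Factors are peeled off one at a time: either the remaining product already kills [y], or its
   value at [y] is the eigenvector sought. *)
have kill (r : seq K) y :
    b \notin r -> y != 0 -> act (\prod_(c <- r) ('X - c%:P)) y = 0 ->
    exists w c, [/\ w != 0, c != b & w * f b = f c * w].
  elim: r => [|c r IH]; first by rewrite big_nil act1 => _ /eqP.
  rewrite inE negb_or eq_sym big_cons => /andP[cb br] y0; rewrite actM.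
  set z := act _ y => /eqP; rewrite subr_eq0 => /eqP zc.
  have [z0|z0] := eqVneq z 0; first exact: IH br y0 z0.
  by exists z, c.
(* This is ['X - b%:P] applied to [x], nonzero by hypothesis, so the factors other than ['X - b%:P]
   kill it. *)
pose y := x * f b - f b * x.
apply: (kill (rem b (enum K)) y); rewrite ?subr_eq0 //.
  by rewrite mem_rem_uniq ?enum_uniq // inE eqxx.
have actZ p : act p y = act (('X - b%:P) * p) x.
  rewrite actM /act /y mulr_suml mulr_sumr -sumrB; apply: eq_bigr => j _.
  rewrite mulrBr mulrBl !mulrA; congr (_ - _).
    by rewrite -!mulrA -exprS -exprSr.
  by rewrite -!rmorphM mulrC.
rewrite actZ.
have <- : \prod_(c : K) ('X - c%:P) =
          ('X - b%:P) * \prod_(c <- rem b (enum K)) ('X - c%:P).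
  by rewrite -big_enum (perm_big _ (perm_to_rem (mem_enum predT b))) big_cons.
rewrite -finField_genPoly.
have q1 := finNzRing_gt1 K.
have szq : (size ('X^#|K| - 'X : {poly K})%R <= #|K|.+1)%N.
  by rewrite size_polyDl size_polyXn // size_polyN size_polyX.
rewrite (actE _ _ _ szq).
under eq_bigr => j _ do rewrite coefB coefXn coefX rmorphB !mulrBl.
have delta m : (m < #|K|.+1)%N ->
    \sum_(j < #|K|.+1) f ((j : nat) == m)%:R * x * f b ^+ j = x * f b ^+ m.
  move=> mq; rewrite (bigD1 (Ordinal mq)) //= eqxx rmorph1 mul1r big1 ?addr0 // => j.
  by rewrite -val_eqE /= => /negbTE ->; rewrite rmorph0 !mul0r.
rewrite sumrB !delta //; last exact: ltnW.
by rewrite -rmorphXn expf_card expr1 subrr.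
Qed.

(** * Jacobson's commutativity theorem for skew fields of finite exponent *)

Section Commutativity.
Variables (D : unitRingType) (k : nat).
Hypothesis Dk : torsion_skew_field D k.

Lemma finite_subring_comm (s : seq D) :
  subring_closed (mem s) -> {in s &, commutative (@GRing.mul D)}.
Proof.
move=> /(finite_subring_field Dk)[K [f fP]] x y /fP[x' <-] /fP[y' <-].
by rewrite -!rmorphM mulrC.
Qed.

(** If [a] is not central, it generates a finite field, and the eigenvector lemma gives a nonzero
    [w] with [w * a = d' * w] for some [d' != a] in that field. But [a] and [w] lie in a finite,
    hence commutative, subring; cancelling [w] gives [d' = a]. *)
Lemma torsion_skew_field_comm : commutative (@GRing.mul D).
Proof.
move=> x a; apply/eqP/negP => /negP nxa; have [k0 _] := Dk.
have a0 : a != 0 by apply: contraNneq nxa => ->; rewrite mulr0 mul0r.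
have [c c0 cD] := torsion_finite_char Dk.
have powP (y : D) i : y != 0 -> exists j : 'I_k, y ^+ i = y ^+ j.
  by move=> y0; exists (Ordinal (ltn_pmod i k0)); rewrite //= torsion_expr_mod.
(* Since [a ^+ k = 1], exponents below [k] already give all powers of [a]. *)
pose G := [seq a ^+ (i : 'I_k) | i : 'I_k].
have GX i : a ^+ i \in G.
  by have [j ->] := powP a i a0; apply/mapP; exists j; rewrite ?mem_enum.
have [||s [sring Gs] sind] := finite_subring_span c0 cD (G := G).
- by rewrite -(expr0 a).
- by move=> _ _ /mapP[i _ ->] /mapP[j _ ->]; rewrite -exprD.
have [s1 sB sM] := sring.
have s0 : 0 \in s by rewrite -(subrr 1); apply: sB.
have sD : {in s &, forall y z, y + z \in s}.
  by move=> y z ys zs; rewrite -[z]opprK; apply: (sB) => //;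
    rewrite -sub0r; apply: sB.
have as_ : a \in s by rewrite -(expr1 a); apply: Gs.
have [K [f fP]] := finite_subring_field Dk sring.
have [b fb] := (fP a).1 as_.
rewrite -fb in nxa; have [w [d [w0 dNb wd]]] := bimodule_eigenvector nxa.
rewrite fb in wd; set d' := f d in wd.
have d's : d' \in s by apply/fP; exists d.
have sX y n : y \in s -> y ^+ n \in s.
  by move=> ys; elim: n => [|n IH]; rewrite ?expr0 // exprS; apply: sM.
(* w normalises the subring s generated by a, so a and w generate a finite
   subring t, in which they commute by Wedderburn's theorem. *)
have wa n : w * a ^+ n = d' ^+ n * w.
  elim: n => [|n IH]; first by rewrite !expr0 mulr1 mul1r.
  by rewrite exprSr mulrA IH -mulrA wd mulrA -exprSr.
have ws : {in s, forall y, exists2 y', y' \in s & w * y = y' * w}.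
  apply: sind => [|y z [y' y's yE] [z' z's zE]|_ /mapP[i _ ->]].
  - by exists 0; rewrite // mulr0 mul0r.
  - by exists (y' + z'); [apply: sD|rewrite mulrDr yE zE mulrDl].
  - by exists (d' ^+ i); [apply: sX|apply: wa].
have wsX n : {in s, forall y, exists2 y', y' \in s & w ^+ n * y = y' * w ^+ n}.
  elim: n => [|n IH] y ys; first by exists y; rewrite // mul1r mulr1.
  have [y' /ws[z zs zE] yE] := IH y ys; exists z => //.
  by rewrite exprS -mulrA yE mulrA zE mulrA.
pose H := [seq y * w ^+ (i : 'I_k) | y <- s, i <- enum 'I_k].
have HX y i : y \in s -> y * w ^+ i \in H.
  by move=> ys; have [j ->] := powP w i w0; apply: allpairs_f; rewrite ?mem_enum.
have [||t [tring Ht] _] := finite_subring_span c0 cD (G := H).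
- by rewrite -(mulr1 1) -(expr0 w); apply: HX.
- move=> _ _ /allpairsP[[y i] /= [ys _ ->]] /allpairsP[[z j] /= [zs _ ->]].
  have [z' z's zE] := wsX i z zs.
  by rewrite mulrA -(mulrA y) zE -!mulrA -exprD mulrA; apply/HX/sM.
have aT : a \in t by apply: Ht; rewrite -(mulr1 a) -(expr0 w); apply: HX.
have wT : w \in t by apply: Ht; rewrite -(mul1r w) -(expr1 w); apply: HX.
have := wd; rewrite (finite_subring_comm tring wT aT).
move/(mulIr (torsion_unit Dk w0)) => ad.
by move: dNb; rewrite -(inj_eq (fmorph_inj f)) fb -/d' ad eqxx.
Qed.

(** By commutativity the roots of ['X^(k.+1) - 'X], which are all elements of [D], number at most
    [k.+1]; a duplicate-free list of maximal length is then exhaustive. *)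
Lemma torsion_skew_field_finite : exists s : seq D, forall x, x \in s.
Proof.
have [k0 torD] := Dk.
have bound (r : seq D) : uniq r -> (size r <= k.+1)%N.
  move=> ur; pose p : {poly D} := 'X^(k.+1) - 'X.
  have szp : size p = k.+2.
    by rewrite size_polyDl size_polyXn // size_polyN size_polyX.
  rewrite -ltnS -szp; apply: max_ring_poly_roots.
  - by rewrite -size_poly_eq0 szp.
  - apply/allP => y _; rewrite rootE !hornerE hornerXn exprS.
    by have [->|/torD ->] := eqVneq y 0; rewrite ?mul0r ?mulr1 ?subrr.
  elim: r ur => //= y r IH /andP[yr ur]; rewrite IH // andbT.
  apply/allP => z zr; rewrite /diff_roots torsion_skew_field_comm eqxx /=.
  by apply: (torsion_unit Dk); rewrite subr_eq0; apply: contraNneq yr => <-.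
pose P n := `[< exists2 r : seq D, uniq r & size r = n >].
have P0 : exists n, P n by exists 0%N; apply/asboolP; exists [::].
have Pb n : P n -> (n <= k.+1)%N by move=> /asboolP[r ur <-]; apply: bound.
case: (ex_maxnP P0 Pb) => n /asboolP[r ur rn] nmax; exists r => y.
apply/negPn/negP => yr; have /nmax : P n.+1; last by rewrite ltnn.
by apply/asboolP; exists (y :: r); rewrite /= ?yr ?rn.
Qed.

Lemma torsion_skew_field_iso_finField :
  exists (K : finFieldType) (g : {rmorphism D -> K}), bijective g.
Proof.
have [s sD] := torsion_skew_field_finite.
have [|K [f fP]] := @finite_subring_field _ _ Dk s; first by split.
have /choice[g gK] (x : D) : exists y, f y = x by apply/fP.
have fI : injective f by exact: fmorph_inj.
have gB : zmod_morphism g by move=> x y; apply: fI; rewrite rmorphB !gK.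
have gM : monoid_morphism g.
  by split=> [|x y]; apply: fI; rewrite ?rmorph1 ?rmorphM !gK.
pose mB := GRing.isZmodMorphism.Build _ _ g gB.
pose mM := GRing.isMonoidMorphism.Build _ _ g gM.
pose h : {rmorphism _ -> _} := HB.pack g mB mM.
by exists K, h, f => // x; apply: fI; rewrite gK.
Qed.

End Commutativity.

(** * Quotients by two-sided ideals *)

Definition two_sided_ideal (R : pzRingType) (I : R -> Prop) : Prop :=
  [/\ I 0, forall x y, I x -> I y -> I (x - y), forall r x, I x -> I (r * x)
    & forall x r, I x -> I (x * r)].

Lemma sub_closed_opp_add (V : zmodType) (I : V -> Prop) :
    I 0 -> (forall x y, I x -> I y -> I (x - y)) ->
  (forall x, I x -> I (- x)) /\ (forall x y, I x -> I y -> I (x + y)).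
Proof.
move=> I0 IB; have IN x : I x -> I (- x) by rewrite -sub0r; apply: IB.
by split=> // x y Ix Iy; rewrite -[y]opprK; apply/IB/IN.
Qed.

Section QuotientRing.
Variables (R : pzRingType) (I : R -> Prop).
Hypothesis idI : two_sided_ideal I.

Let I0 : I 0. Proof. by case: idI. Qed.
Let IN x : I x -> I (- x).
Proof. by case: idI => _ IB _ _; apply: (sub_closed_opp_add I0 IB).1. Qed.
Let ID x y : I x -> I y -> I (x + y).
Proof. by case: idI => _ IB _ _; apply: (sub_closed_opp_add I0 IB).2. Qed.

(** [choose] depends only on the predicate, so congruent elements get the same representative. The
    quotient can thus be the subtype of [R] fixed by [quo_repr]. *)
Definition quo_repr (x : R) : R := choose (fun y => `[< I (y - x) >]) x.

Lemma quo_reprP x : I (quo_repr x - x).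
Proof.
apply/asboolP/(@chooseP _ (fun y => `[< I (y - x) >]) x).
by apply/asboolP; rewrite subrr.
Qed.

Lemma quo_repr_eq x y : I (x - y) -> quo_repr x = quo_repr y.
Proof.
move=> Ixy; rewrite /quo_repr.
have eqP : (fun z => `[< I (z - x) >]) =1 (fun z => `[< I (z - y) >]).
  move=> z; apply/asbool_equiv_eq; split=> Iz.
    by rewrite -(subrKA x z); apply: ID.
  by rewrite -(subrKA y z); apply: ID => //; rewrite -opprB; apply: IN.
rewrite (eq_choose eqP); apply: choose_id; apply/asboolP => //.
by rewrite subrr.
Qed.

Definition quo_ring of two_sided_ideal I := {x : R | quo_repr x == x}.
Local Notation Q := (quo_ring idI).
HB.instance Definition _ := SubChoice.on Q.

Lemma quo_mk_subproof x : quo_repr (quo_repr x) == quo_repr x.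
Proof. exact/eqP/quo_repr_eq/quo_reprP. Qed.

Definition quo_mk (x : R) : Q := exist _ (quo_repr x) (quo_mk_subproof x).

Lemma quo_mk_eqP x y : quo_mk x = quo_mk y <-> I (x - y).
Proof.
split=> [/(congr1 val) /= xy|/quo_repr_eq xy]; last exact: val_inj.
rewrite -(subrKA (quo_repr x) x) {2}xy -(opprB (quo_repr x) x).
by apply: ID; [apply/IN/quo_reprP|apply: quo_reprP].
Qed.

Lemma quo_mkK (a : Q) : quo_mk (val a) = a.
Proof. exact/val_inj/eqP/(valP a). Qed.

Let add (a b : Q) := quo_mk (val a + val b).
Let opp (a : Q) := quo_mk (- val a).
Let mul (a b : Q) := quo_mk (val a * val b).

Let mkD x y : add (quo_mk x) (quo_mk y) = quo_mk (x + y).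
Proof.
by apply/quo_mk_eqP; rewrite opprD addrACA; apply: ID; exact: quo_reprP.
Qed.

Let mkN x : opp (quo_mk x) = quo_mk (- x).
Proof.
by apply/quo_mk_eqP; rewrite -opprD; apply/IN/quo_reprP.
Qed.

Let mkM x y : mul (quo_mk x) (quo_mk y) = quo_mk (x * y).
Proof.
have [_ _ Il Ir] := idI; apply/quo_mk_eqP => /=.
have -> : quo_repr x * quo_repr y - x * y =
   quo_repr x * (quo_repr y - y) + ((quo_repr x - x) * y).
  by rewrite mulrBr mulrBl addrA subrK.
by apply: ID; [apply/Il/quo_reprP|apply/Ir/quo_reprP].
Qed.

Let addA : associative add.
Proof. by move=> a b c; rewrite -(quo_mkK a) -(quo_mkK b) -(quo_mkK c)
  !(mkD, mkN, mkM) addrA. Qed.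
Let addC : commutative add.
Proof. by move=> a b; rewrite -(quo_mkK a) -(quo_mkK b) !(mkD, mkN, mkM) addrC. Qed.
Let add0 : left_id (quo_mk 0) add.
Proof. by move=> a; rewrite -(quo_mkK a) !(mkD, mkN, mkM) add0r. Qed.
Let addN : left_inverse (quo_mk 0) opp add.
Proof. by move=> a; rewrite -(quo_mkK a) !(mkD, mkN, mkM) addNr. Qed.
Let mulA : associative mul.
Proof. by move=> a b c; rewrite -(quo_mkK a) -(quo_mkK b) -(quo_mkK c)
  !(mkD, mkN, mkM) mulrA. Qed.
Let mul1 : left_id (quo_mk 1) mul.
Proof. by move=> a; rewrite -(quo_mkK a) !(mkD, mkN, mkM) mul1r. Qed.
Let mulq1 : right_id (quo_mk 1) mul.
Proof. by move=> a; rewrite -(quo_mkK a) !(mkD, mkN, mkM) mulr1. Qed.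
Let mulDl : left_distributive mul add.
Proof. by move=> a b c; rewrite -(quo_mkK a) -(quo_mkK b) -(quo_mkK c)
  !(mkD, mkN, mkM) mulrDl. Qed.
Let mulDr : right_distributive mul add.
Proof. by move=> a b c; rewrite -(quo_mkK a) -(quo_mkK b) -(quo_mkK c)
  !(mkD, mkN, mkM) mulrDr. Qed.

HB.instance Definition _ := GRing.isPzRing.Build Q
  addA addC add0 addN mulA mul1 mulq1 mulDl mulDr.

Lemma quo_mk_zmod_morphism : zmod_morphism quo_mk.
Proof. by move=> x y; rewrite -mkD -mkN. Qed.

Lemma quo_mk_monoid_morphism : monoid_morphism quo_mk.
Proof. by split=> [|x y] //; rewrite -mkM. Qed.

HB.instance Definition _ :=
  GRing.isZmodMorphism.Build R Q quo_mk quo_mk_zmod_morphism.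
HB.instance Definition _ :=
  GRing.isMonoidMorphism.Build R Q quo_mk quo_mk_monoid_morphism.

Lemma quo_mk_eq0 x : quo_mk x = 0 <-> I x.
Proof. by rewrite -(rmorph0 quo_mk) quo_mk_eqP subr0. Qed.

End QuotientRing.

(** The quotient by [I] is a skew field of exponent [k], hence isomorphic to a finite field; [g] is
    the projection followed by this isomorphism. *)
Lemma quo_torsion_finField (R : pzRingType) (I : R -> Prop) k :
    two_sided_ideal I -> ~ I 1 -> (0 < k)%N -> (forall x, ~ I x -> I (x ^+ k - 1)) ->
  exists (K : finFieldType) (g : {rmorphism R -> K}),
    (forall y, exists x, g x = y) /\ (forall x, g x = 0 <-> I x).
Proof.
move=> idI I1 k0 Ik.
pose Q := quo_ring idI; pose mk : {rmorphism R -> Q} := quo_mk idI.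
have mk0 x : mk x = 0 <-> I x by exact: quo_mk_eq0.
have Q10 : (1 : Q) != 0 by apply/eqP => /(etrans (rmorph1 mk)) /mk0.
have Qk (y : Q) : y != 0 -> y ^+ k = 1.
  rewrite -(quo_mkK y) => /eqP y0; apply/eqP; rewrite -subr_eq0; apply/eqP.
  rewrite -[quo_mk _ _]/(mk _) -rmorphXn -(rmorph1 mk) -rmorphB.
  by apply/mk0/Ik => /mk0.
(* Nontriviality and then units are added to the bare quotient, with [y ^+ k.-1] as the inverse of a
   nonzero [y]. *)
pose mz := GRing.PzSemiRing_isNonZero.Build Q Q10.
pose Qz : nzRingType := HB.pack Q mz.
pose inv (y : Qz) : Qz := if y == 0 then y else y ^+ k.-1.
have invl : {in [pred y : Qz | y != 0], left_inverse 1 inv *%R}.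
  move=> y; rewrite inE /inv => y0; rewrite (negbTE y0) -exprSr prednK //.
  exact: Qk y0.
have invr : {in [pred y : Qz | y != 0], right_inverse 1 inv *%R}.
  move=> y; rewrite inE /inv => y0; rewrite (negbTE y0) -exprS prednK //.
  exact: Qk y0.
have unitP (x y : Qz) : y * x = 1 /\ x * y = 1 -> [pred y : Qz | y != 0] x.
  move=> [yx _] /=; apply/eqP => x0; move: yx; rewrite x0 mulr0 => /esym/eqP.
  by rewrite oner_eq0.
have invo : {in [predC [pred y : Qz | y != 0]], inv =1 id}.
  by move=> y; rewrite inE /= negbK /inv => ->.
pose mu := GRing.NzRing_hasMulInverse.Build Qz invl invr unitP invo.
pose Qu : unitRingType := HB.pack Qz mu.
have torQ : torsion_skew_field Qu k by split=> // x; exact: Qk.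
have [K [g [h gK hK]]] := torsion_skew_field_iso_finField torQ.
pose gm := (g : Q -> K) \o mk.
have gB : zmod_morphism gm.
  by move=> x y; rewrite /gm /= (rmorphB mk) (rmorphB g).
have gM : monoid_morphism gm.
  split=> [|x y]; first by rewrite /gm /= (rmorph1 mk) (rmorph1 g).
  by rewrite /gm /= (rmorphM mk) (rmorphM g).
pose mB := GRing.isZmodMorphism.Build _ _ gm gB.
pose mM := GRing.isMonoidMorphism.Build _ _ gm gM.
pose G : {rmorphism _ -> _} := HB.pack gm mB mM.
exists K, G; split=> [y|x].
  by exists (val (h y : Q)); rewrite /= /gm /= quo_mkK hK.
rewrite -mk0 /= /gm /=; split=> [gx|->]; last exact: (rmorph0 g).
by apply: (can_inj gK); rewrite gx; apply/esym/(rmorph0 g).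
Qed.

Lemma quo_lift (R S : pzRingType) (I : R -> Prop) (idI : two_sided_ideal I)
    (g : {rmorphism R -> S}) :
  (forall x, I x -> g x = 0) ->
  exists h : {rmorphism quo_ring idI -> S}, forall x, h (quo_mk idI x) = g x.
Proof.
move=> gI; pose h (q : quo_ring idI) := g (val q).
have hE x : h (quo_mk idI x) = g x.
  by apply/eqP; rewrite -subr_eq0 -rmorphB gI //; apply: quo_reprP.
have hB : zmod_morphism h.
  by move=> a b; rewrite -(quo_mkK a) -(quo_mkK b) -rmorphB !hE rmorphB.
have hM : monoid_morphism h.
  split=> [|a b]; first by rewrite -(rmorph1 (quo_mk idI)) hE rmorph1.
  by rewrite -(quo_mkK a) -(quo_mkK b) -rmorphM !hE rmorphM.
pose mB := GRing.isZmodMorphism.Build _ _ h hB.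
pose mM := GRing.isMonoidMorphism.Build _ _ h hM.
pose H : {rmorphism _ -> _} := HB.pack h mB mM.
by exists H.
Qed.

(** * Abelian rings in which every k-th power is idempotent *)

Section MaximalLeftIdeals.
Local Open Scope classical_set_scope.
Variable R : unitRingType.
Implicit Types (M A : R -> Prop) (x y r e : R).

Lemma left_ideal_opp_add A : left_ideal A ->
  (forall x, A x -> A (- x)) /\ (forall x y, A x -> A y -> A (x + y)).
Proof. by case=> A0 AB _; exact: sub_closed_opp_add. Qed.

Lemma maximal_left_ideal_exists A : left_ideal A -> ~ A 1 ->
  exists2 M, maximal_left_ideal M & forall x, A x -> M x.
Proof.
move=> idA A1.
pose P : set (set R) := fun B => (B = set0) \/ [/\ left_ideal B, ~ B 1 & A `<=` B].
have PU (F : set (set R)) : F `<=` P -> total_on F subset -> P (\bigcup_(X in F) X).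
  move=> FP Ftot.
  have [[B [FB B0]]|nF] := pselect (exists B, F B /\ B !=set0); last first.
    left; apply/seteqP; split=> // x [B FB Bx]; apply: nF.
    by exists B; split=> //; exists x.
  right; have FE C x : F C -> C x -> [/\ left_ideal C, ~ C 1 & A `<=` C].
    by move=> /FP[->|].
  split; [split|..].
  - by case: B0 => x Bx; exists B => //; case: (FE B x FB Bx) => [[]].
  - move=> x y [C FC Cx] [C' FC' C'y].
    have [[_ CB _] _ _] := FE C x FC Cx; have [[_ C'B _] _ _] := FE C' y FC' C'y.
    have [CC'|C'C] := Ftot C C' FC FC'; [exists C' => //|exists C => //].
      by apply: C'B => //; apply: CC'.
    by apply: CB => //; apply: C'C.
  - by move=> r x [C FC Cx]; exists C => //;
    case: (FE C x FC Cx) => [[_ _ +] _ _]; apply.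
  - by move=> [C FC C1]; case: (FE C 1 FC C1).
  - by case: B0 => x Bx y Ay; exists B => //; case: (FE B x FB Bx) => _ _; apply.
have [M [PM Mmax]] := Zorn_bigcup PU.
have PA : P A by right; split.
have [idM M1 AM] : [/\ left_ideal M, ~ M 1 & A `<=` M].
  case: PM => // M0; exfalso; apply: (Mmax A) => //; rewrite M0.
  by split=> // /(_ 0); apply; case: idA.
exists M => //; split=> // N idN MN.
have [N1|N1] := pselect (N 1); [by right|left].
have [NM|/existsNP[x /not_implyP[Nx nMx]]] := pselect (forall x, N x -> M x).
  by move=> x; split; [apply: NM|apply: MN].
exfalso; apply: (Mmax N); first by split=> // /(_ x Nx).
by right; split=> // y Ay; apply/MN/AM.
Qed.

(** The left ideal [N], which is [M + R x], strictly contains [M] and so contains [1]. *)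
Lemma maximal_left_ideal_inv M x :
  maximal_left_ideal M -> ~ M x -> exists y, M (1 - y * x).
Proof.
move=> [idM M1 Mmax] nMx; have [M0 MB Ml] := idM.
have [MN MD] := left_ideal_opp_add idM.
pose N z := exists y, M (z - y * x).
have MsubN z : M z -> N z by exists 0; rewrite mul0r subr0.
have idN : left_ideal N.
  split; first exact: MsubN.
    move=> y z [a Ma] [b Mb]; exists (a - b).
    by rewrite mulrBl opprD addrACA -opprD; apply: MB.
  by move=> r z [a Ma]; exists (r * a); rewrite -mulrA -mulrBr; apply: Ml.
have [NM|//] := Mmax N idN MsubN.
by exfalso; apply/nMx/NM; exists 1; rewrite mul1r subrr.
Qed.

Lemma jacobson_left_ideal : left_ideal (@jacobson R).
Proof.
split=> [M [[]]|x y Jx Jy M mM|r x Jx M mM] //; have [[_ MB Ml] _ _] := mM.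
  by apply: MB; [apply: Jx|apply: Jy].
by apply: Ml; apply: Jx.
Qed.

End MaximalLeftIdeals.

Lemma nilpotent_sub1_inv (R : pzRingType) (x : R) n : x ^+ n = 0 ->
  exists2 z, z * (1 - x) = 1 & (1 - x) * z = 1.
Proof.
move=> xn; have E := subrX1 x n; rewrite xn sub0r in E.
exists (\sum_(i < n) x ^+ i); apply/oppr_inj; last by rewrite E -mulNr opprB.
rewrite E -mulrN opprB; apply/esym/commr_sum => i _.
by apply/commr_sym/commrB; [apply/commr_sym/commrX|apply: commr1].
Qed.

Section Periodic.
Variables (R : unitRingType) (k : nat).
Hypothesis Rab : abelian_ring R.
Hypothesis k_gt0 : (0 < k)%N.
Hypothesis Rk : forall r : R, idempotent (r ^+ k).
Implicit Types (M : R -> Prop) (x y r e : R).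

(** Some [1 - y * e] lies in [M]; multiplying it on the left by [1 - e] gives [1 - e], as [e] is
    central. *)
Lemma maximal_left_ideal_idem M e :
  maximal_left_ideal M -> idempotent e -> ~ M e -> M (1 - e).
Proof.
move=> mM ee /(maximal_left_ideal_inv mM)[y My]; have [[_ _ Ml] _ _] := mM.
have -> : 1 - e = (1 - e) * (1 - y * e); last exact: Ml.
by rewrite -(Rab ee y) mulrBr mulr1 mulrA mulrBl mul1r ee subrr mul0r subr0.
Qed.

(** If [x] is outside [M], some [1 - y * x] lies in [M]. The nilpotency of [x] forces
    [(y * x) ^+ k = 0], so [1 - y * x] is invertible, which is absurd. *)
Lemma nilpotent_jacobson x n : x ^+ n = 0 -> jacobson x.
Proof.
move=> xn M mM; apply: contrapT => /(maximal_left_ideal_inv mM)[y My].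
have [[_ _ Ml] M1 _] := mM.
set e := (y * x) ^+ k; have ee : idempotent e by exact: Rk.
pose z := (y * x) ^+ k.-1 * y.
have ez : e = z * x by rewrite /z -mulrA -exprSr prednK.
(* Inductively, [z * e * x = e * (z * x) = e * e = e], by centrality of [e]. *)
have eX m : e = z ^+ m.+1 * x ^+ m.+1.
  elim: m => [|m IH]; first by rewrite !expr1.
  by rewrite [z ^+ _]exprS [x ^+ _]exprSr -mulrA (mulrA _ _ x)
    -IH (Rab ee) mulrA -ez ee.
have e0 : e = 0 by rewrite (eX n) [x ^+ _]exprSr xn mul0r mulr0.
have [t tE _] := nilpotent_sub1_inv e0.
by apply: M1; rewrite -tE; apply: Ml.
Qed.

(** If [e = x ^+ k] were nonzero, its left annihilator [A] would lie in a maximal left ideal; that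
    ideal would contain both [1 - e] and [e]. *)
Lemma jacobson_nilpotent x : jacobson x -> x ^+ k = 0.
Proof.
move=> Jx; set e := x ^+ k; have ee : idempotent e by exact: Rk.
apply: contrapT => e0; pose A z := z * e = 0.
have idA : left_ideal A.
  split=> [|y z ye ze|r y ye]; rewrite /A ?mul0r //.
    by rewrite mulrBl ye ze subrr.
  by rewrite -mulrA ye mulr0.
have A1 : ~ A 1 by rewrite /A mul1r.
have [M mM AM] := maximal_left_ideal_exists idA A1.
have [idM M1 _] := mM; have [_ _ Ml] := idM.
have [_ MD] := left_ideal_opp_add idM; apply: M1; rewrite -(subrK e 1); apply: MD.
  by apply: AM; rewrite /A mulrBl mul1r ee subrr.
by rewrite /e -(prednK k_gt0) exprSr; apply: Ml; apply: Jx.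
Qed.

(** The [k]-th power of this element has the factor [x ^+ k * (1 - x ^+ k) = 0]. *)
Lemma jacobson_periodic_part x : jacobson (x * (1 - x ^+ k)).
Proof.
apply: (@nilpotent_jacobson _ k); rewrite exprMn_comm; last first.
  by apply: commrB; [apply: commr1|apply: commrX].
rewrite -(prednK k_gt0) [X in _ * X]exprS prednK // mulrA mulrBr mulr1.
by rewrite Rk subrr mul0r.
Qed.

(** For [x] in the radical, [r * x] is nilpotent, hence so is [x * r], and nilpotents belong to the
    radical. *)
Lemma jacobson_two_sided : two_sided_ideal (@jacobson R).
Proof.
have [J0 JB Jl] := jacobson_left_ideal R; split=> // x r Jx.
apply: (@nilpotent_jacobson _ k.+1).
have E m : (x * r) ^+ m.+1 = x * (r * x) ^+ m * r.
  elim: m => [|m IH]; first by rewrite expr1 expr0 mulr1.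
  by rewrite exprSr IH exprSr !mulrA.
by rewrite E (jacobson_nilpotent (Jl r x Jx)) mulr0 mul0r.
Qed.

(** Split [x * r] as [x * (1 - x ^+ k) * r], which lies in the radical, plus [x * r * x ^+ k], a
    left multiple of [x]. *)
Lemma maximal_left_ideal_two_sided M : maximal_left_ideal M -> two_sided_ideal M.
Proof.
move=> mM; have [idM _ _] := mM; have [M0 MB Ml] := idM; split=> // x r Mx.
have [_ _ _ Jr] := jacobson_two_sided.
have -> : x * r = x * (1 - x ^+ k) * r + x * r * x ^+ k.
  by rewrite mulrBr mulr1 mulrBl -!mulrA (Rab (Rk x)) subrK.
have [_ MD] := left_ideal_opp_add idM; apply: MD.
  exact: Jr (jacobson_periodic_part x) _ mM.
by apply: (Ml); rewrite -(prednK k_gt0) exprSr; apply: Ml.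
Qed.

(** Modulo the radical [x] is [x * x ^+ k], so the idempotent [x ^+ k] is outside [M] and its
    complement is inside. *)
Lemma maximal_left_ideal_torsion M x :
  maximal_left_ideal M -> ~ M x -> M (x ^+ k - 1).
Proof.
move=> mM nMx; have [idM _ _] := mM; have [M0 MB Ml] := idM.
have [MN MD] := left_ideal_opp_add idM.
rewrite -opprB; apply: MN; apply: maximal_left_ideal_idem => //.
move=> Mxk; apply: nMx.
have -> : x = x * (1 - x ^+ k) + x * x ^+ k by rewrite mulrBr mulr1 subrK.
by apply: MD; [apply: jacobson_periodic_part|apply: Ml].
Qed.

(** All positive powers of [a] are congruent to [a], so [a ^+ k] is a lift. For congruent central
    idempotents [g] and [h], [g - g * h] is a nilpotent idempotent, hence zero; by symmetry
    [g = h]. *)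
Lemma periodic_idempotents_lift : idempotents_lift_uniquely (@jacobson R).
Proof.
move=> a Ja; have [J0 JB Jl] := jacobson_left_ideal R.
have [JN JD] := left_ideal_opp_add (jacobson_left_ideal R).
have JX m : jacobson (a ^+ m.+1 - a).
  elim: m => [|m IH]; first by rewrite expr1 subrr.
  rewrite exprS; have -> : a * a ^+ m.+1 - a = a * (a ^+ m.+1 - a) + (a * a - a).
    by rewrite mulrBr addrA subrK.
  by apply: JD => //; apply: Jl.
exists (a ^+ k); split; first by split; [exact: Rk|rewrite -(prednK k_gt0)].
move=> e ee Jea; have : jacobson (e - a ^+ k).
  rewrite -(subrKA a e) -[a - _]opprB.
  by apply: JB => //; rewrite -(prednK k_gt0).
set f := a ^+ k; have ff : idempotent f by exact: Rk.
move=> Jef.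
have J_idem (g h : R) :
    idempotent g -> idempotent h -> jacobson (g - h) -> g = g * h.
  move=> gg hh Jgh; apply/eqP; rewrite -subr_eq0; apply/eqP.
  have Jd : jacobson (g - g * h) by have := Jl g _ Jgh; rewrite mulrBr gg.
  have dd : (g - g * h) * (g - g * h) = g - g * h.
    have E : (g - g * h) * g = g - g * h.
      by rewrite mulrBl gg -mulrA (Rab hh g) mulrA gg.
    by rewrite mulrBr mulrA E mulrBl -mulrA hh subrr subr0.
  rewrite -(jacobson_nilpotent Jd) -(prednK k_gt0).
  by elim: k.-1 => [|m IH]; rewrite ?expr1 // exprS -IH.
rewrite (J_idem e f ee ff Jef) (Rab ee f) -(J_idem f e ff ee) //.
by rewrite -opprB; apply: JN.
Qed.

End Periodic.

(** * Subdirect decomposition of the quotient by the radical *)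

Lemma lcm_family_exists (T : Type) (a : T -> nat) B :
    (0 < B)%N -> (forall i, (a i %| B)%N) ->
  exists L : nat, [/\ (0 < L)%N, forall i, (a i %| L)%N &
    forall m : nat, (forall i, (a i %| m)%N) -> (L %| m)%N].
Proof.
move=> B0 aB; pose P m := (0 < m)%N && `[< forall i, (a i %| m)%N >].
have exP : exists m, P m by exists B; rewrite /P B0; apply/asboolP.
case: (ex_minnP exP) => L /andP[L0 /asboolP aL] Lmin; exists L; split=> // m am.
(* The remainder of a common multiple is again one, and below the least positive [L] it must be
   zero. *)
have : ~~ P (m %% L)%N by apply/negP => /Lmin; rewrite leqNgt ltn_pmod.
rewrite /P negb_and -leqNgt leqn0 => /orP[//|/asboolP[]] i.
by rewrite -(dvdn_addr _ (dvdn_mull (m %/ L) (aL i))) -divn_eq.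
Qed.

Lemma finField_card_le (F : finFieldType) k :
  (0 < k)%N -> (forall y : F, y != 0 -> y ^+ k = 1) -> (#|F| <= k.+1)%N.
Proof.
move=> k0 Fk; pose p : {poly F} := 'X^(k.+1) - 'X.
have szp : size p = k.+2.
  by rewrite size_polyDl size_polyXn // size_polyN size_polyX.
rewrite cardE -ltnS -szp; apply: max_poly_roots; last exact: enum_uniq.
  by rewrite -size_poly_eq0 szp.
apply/allP => y _; rewrite rootE !hornerE exprS.
by have [->|/Fk ->] := eqVneq y 0; rewrite ?mul0r ?mulr1 ?subrr.
Qed.

Lemma periodic_quotient (R : unitRingType) k :
    abelian_ring R -> (0 < k)%N -> (forall r : R, idempotent (r ^+ k)) ->
  quotient_subdirect_finite_fields_lcm (@jacobson R).
Proof.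
move=> Rab k0 Rk; have idJ := jacobson_two_sided Rab k0 Rk.
exists (quo_ring idJ), (quo_mk idJ); split.
  by move=> y; exists (val y); exact: quo_mkK.
split=> [x|]; first exact: quo_mk_eq0.
(* One field per maximal left ideal: these intersect in the radical, which makes the family [f]
   jointly injective. *)
pose I := {M : R -> Prop | maximal_left_ideal M}.
have exF (i : I) : exists F : finFieldType, exists g : {rmorphism quo_ring idJ -> F},
    [/\ forall y, exists q, g q = y, forall x, g (quo_mk idJ x) = 0 <-> sval i x
      & (#|F| - 1 %| k`!)%N].
  case: i => M mM /=; have [_ M1 _] := mM.
  have Mk x : ~ M x -> M (x ^+ k - 1) by exact: maximal_left_ideal_torsion.
  have [K [g [gsurj gM]]] :=
    quo_torsion_finField (maximal_left_ideal_two_sided Rab k0 Rk mM) M1 k0 Mk.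
  have [h hg] : exists h : {rmorphism quo_ring idJ -> K},
      forall x, h (quo_mk idJ x) = g x.
    by apply: quo_lift => x Jx; apply/gM; apply: Jx.
  exists K, h; split=> [y|x|]; last 1 first.
  (* Each [#|F| - 1] is positive and at most [k], so the factorial of [k] is a common multiple. *)
  - apply: dvdn_fact; rewrite subn_gt0 finNzRing_gt1 leq_subLR add1n.
    apply: finField_card_le => // y; have [x <-] := gsurj y => /eqP gx.
    apply/eqP; rewrite -subr_eq0 -rmorphXn -(rmorph1 g) -rmorphB; apply/eqP/gM/Mk.
    by move=> /gM.
  - by have [x <-] := gsurj y; exists (quo_mk idJ x).
  - by rewrite hg gM.
pose F i := projT1 (cid (exF i)).
pose f i : {rmorphism quo_ring idJ -> F i} := projT1 (cid (projT2 (cid (exF i)))).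
have fP i := projT2 (cid (projT2 (cid (exF i)))).
exists I, F, f; split; first by move=> i; case: (fP i).
split=> [q1 q2 fq|].
  apply/eqP; rewrite -subr_eq0 -(quo_mkK (q1 - q2)); apply/eqP/quo_mk_eq0 => M mM.
  have [_ fM _] := fP (exist _ M mM); apply/fM.
  by rewrite quo_mkK rmorphB; apply/eqP; rewrite subr_eq0; apply/eqP/fq.
by apply: (lcm_family_exists (fact_gt0 k)) => i; case: (fP i).
Qed.

(** * Torsion clean abelian rings *)

Section TorsionClean.
Variables (R : unitRingType) (n : nat).
Hypothesis Rab : abelian_ring R.
Hypothesis n_gt0 : (0 < n)%N.
Hypothesis Rn : torsion_clean_with R n.

Lemma torsion_clean_identity (r : R) : (r ^+ n - 1) * ((r - 1) ^+ n - 1) = 0.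
Proof.
have [e [u [ee _ un rE]]] := Rn r.
have corner (f x : R) : idempotent f -> f * x = f * u -> f * x ^+ n = f.
  move=> ff fx; suff E m : f * x ^+ m = f * u ^+ m by rewrite E un mulr1.
  elim: m => [|m IH]; first by rewrite !expr0.
  by rewrite exprSr mulrA IH -mulrA (Rab ff) -mulrA -(Rab ff) fx
    (Rab ff) mulrA -exprSr -(Rab ff).
have ff : idempotent (1 - e).
  by rewrite /idempotent mulrBr mulr1 mulrBl mul1r ee subrr subr0.
(* The element [r] agrees with [u] on the corner of [1 - e], and [r - 1] agrees with [u] on that of
   [e]. *)
have E1 : (1 - e) * (r ^+ n - 1) = 0.
  rewrite mulrBr mulr1 corner ?subrr // rE mulrDr mulrBl mul1r ee subrr.
  by rewrite add0r.
have E2 : e * ((r - 1) ^+ n - 1) = 0.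
  by rewrite mulrBr mulr1 corner ?subrr // rE mulrBr mulrDr mulr1 ee addrC addKr.
by rewrite -[LHS]mul1r -[X in X * _](subrK e 1) mulrDl mulrA E1 mul0r add0r mulrA
  (Rab ee) -mulrA E2 mulr0.
Qed.

(** The value 3 is the least positive integer at which neither factor of the identity is the integer
    zero. *)
Lemma torsion_clean_finite_char : finite_char R.
Proof.
exists ((3 ^ n - 1) * (2 ^ n - 1))%N; split.
  have gt0 b : (1 < b)%N -> (0 < b ^ n - 1)%N.
    by move=> b1; rewrite subn_gt0 -{1}(expn0 b) ltn_exp2l.
  by rewrite muln_gt0 !gt0.
have := torsion_clean_identity 3%:R.
have <- : 2%:R = 3%:R - 1 :> R by rewrite -(@natrB R 3 1).
by rewrite natrM !natrB ?expn_gt0 // !natrX.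
Qed.

End TorsionClean.

(* The exponents come from two powers of 'X that agree modulo c and f, hence are
   the same for all r. *)
Lemma monic_identity_periodic (R : nzRingType) (f : {poly int}) c :
    (0 < c)%N -> c%:R = 0 :> R -> f \is monic ->
    (forall r : R, horner_morph (commr_int r) f = 0) ->
  exists a d, (0 < d)%N /\ forall r : R, r ^+ a = r ^+ (a + d).
Proof.
case: c => // c _ c0 fmon Rf.
have cz0 : (c.+1%:Z)%:~R = 0 :> R by [].
pose d := size f.
pose co i (j : 'I_d) : int := (Pdiv.Ring.rmodp 'X^i f)`_j.
(* There is one more exponent than there are vectors of [d] residues modulo [c.+1], so two exponents
   collide. *)
pose phi (i : 'I_((c.+1 ^ d).+1)) : {ffun 'I_d -> 'I_c.+1} :=
  [ffun j => inord `|(co i j %% c.+1%:Z)%Z|%N].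
have evE (r : R) i : r ^+ i = \sum_(j < d) (co i j)%:~R * r ^+ j.
  have <- : horner_morph (commr_int r) 'X^i = r ^+ i.
    by rewrite rmorphXn /= horner_morphX.
  rewrite {1}(Pdiv.RingMonic.rdivp_eq fmon 'X^i) rmorphD rmorphM /= Rf mulr0 add0r.
  rewrite /horner_morph (@horner_coef_wide _ d).
    by apply: eq_bigr => j _; rewrite coef_map.
  rewrite unlock; apply: leq_trans (size_poly _ _) _; apply/ltnW.
  by rewrite Pdiv.Ring.ltn_rmodp monic_neq0.
have : ~ injective phi.
  move=> /leq_card; rewrite card_ffun !card_ord ltnn //.
move=> /existsNP[i /existsNP[j /not_implyP[phi_ij ij]]].
have modE (z : int) : ((z %% c.+1%:Z)%Z)%:~R = z%:~R :> R.
  by rewrite [in RHS](divz_eq z c.+1%:Z) [RHS]intrD intrM cz0 mulr0 add0r.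
have eq_ij (r : R) : r ^+ i = r ^+ j.
  rewrite !evE; apply: eq_bigr => l _; congr (_ * _).
  have := congr1 (fun g : {ffun 'I_d -> 'I_c.+1} => val (g l)) phi_ij.
  rewrite !ffunE /= !inordK; last 2 first.
  - by rewrite -ltz_nat gez0_abs ?modz_ge0 ?ltz_pmod.
  - by rewrite -ltz_nat gez0_abs ?modz_ge0 ?ltz_pmod.
  move=> /(congr1 Posz); rewrite !gez0_abs ?modz_ge0 // => E.
  by rewrite -modE E modE.
wlog lt_ij : i j ij eq_ij {phi_ij} / (i < j)%N.
  move=> W; case: (ltngtP i j) => [|lt_ji|/val_inj //]; first exact: W.
  by apply: (W j i) => // /esym.
exists i, (j - i)%N; rewrite subn_gt0; split=> // r.
by rewrite subnKC 1?ltnW.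
Qed.

Lemma torsion_clean_periodic (R : unitRingType) n :
    abelian_ring R -> (0 < n)%N -> torsion_clean_with R n ->
  exists2 k, (0 < k)%N & forall r : R, idempotent (r ^+ k).
Proof.
move=> Rab n0 Rn; have [c [c0 cR]] := torsion_clean_finite_char Rab n0 Rn.
pose f : {poly int} := ('X^n - 1) * (('X - 1) ^+ n - 1).
have fmon : f \is monic.
  rewrite monicMl; last by rewrite -polyC1; exact: monicXnsubC.
  rewrite -polyC1 monicE lead_coefDl.
    by rewrite -monicE; apply: monic_exp; exact: monicXsubC.
  by rewrite size_polyN size_polyC oner_neq0 size_exp_XsubC.
have Rf (r : R) : horner_morph (commr_int r) f = 0.
  rewrite /f !(rmorphM, rmorphB, rmorphXn, rmorph1) /= horner_morphX.
  exact: torsion_clean_identity.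
have [a [d [d0 per]]] := monic_identity_periodic c0 cR fmon Rf.
have perM (r : R) m b : (a <= b)%N -> r ^+ (b + m * d) = r ^+ b.
  move=> ab; elim: m => [|m IH]; first by rewrite addn0.
  rewrite mulSn addnA addnAC exprD IH -exprD -(subnK ab) -addnA exprD.
  by rewrite -per -exprD.
(* A positive multiple of the period [d] that is at least [a]: doubling this exponent leaves the
   power unchanged. Using [a.+1] covers [a = 0]. *)
exists (a.+1 * d)%N; first by rewrite muln_gt0.
move=> r; rewrite /idempotent -exprD perM //.
by rewrite (leq_trans (leqnSn a)) // leq_pmulr.
Qed.

(** * Lifting from a subdirect product of finite fields *)

(** Absorption gives [i * 'C(N, i) = N * 'C(N.-1, i.-1)] for [N] equal to [m] times the factorial of
    [k]; [i] divides that factorial, so [m] survives the division by [i]. *)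
Lemma dvdn_bin_mul_fact m k i : (0 < i <= k)%N -> (m %| 'C(m * k`!, i))%N.
Proof.
case: i => // i ik; have iF : (i.+1 %| k`!)%N by apply: dvdn_fact.
apply/dvdnP; exists (k`! %/ i.+1 * 'C((m * k`!).-1, i))%N.
apply/eqP; rewrite -(eqn_pmul2l (ltn0Sn i)) -mul_bin_diag -{1}(divnK iF); apply/eqP.
move: (k`! %/ i.+1)%N 'C(_, _) => q b.
by rewrite (mulnC m) (mulnC q i.+1) -!mulnA (mulnC m).
Qed.

(** In the binomial expansion, terms of degree at least [k] vanish by nilpotency, and the other
    nonconstant ones because [m] divides their coefficients. *)
Lemma exprD1_nilpotent (R : pzRingType) (j : R) m k :
  m%:R = 0 :> R -> j ^+ k = 0 -> (j + 1) ^+ (m * k`!) = 1.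
Proof.
move=> m0 jk; rewrite exprD1n big_ord_recl expr0 bin0 big1 ?addr0 // => i _.
rewrite lift0; have [ki|ik] := leqP k i.+1.
  by rewrite -(subnK ki) exprD jk mulr0 mul0rn.
have /dvdnP[q ->] : (m %| 'C(m * k`!, i.+1))%N.
  by apply: dvdn_bin_mul_fact; rewrite /= ltnW.
by rewrite -mulr_natr natrM m0 !mulr0.
Qed.

Section LiftFromFields.
Variable R : unitRingType.
Implicit Types (x y r e u : R).
Let J := @jacobson R.

(** [J] is a kernel, and the other properties hold in every coordinate: [F i] is commutative, and
    its nonzero elements have order dividing [L]. *)
Lemma subdirect_jacobson : quotient_subdirect_finite_fields_lcm J ->
  two_sided_ideal J /\ (forall x y, J (x * y - y * x)) /\
  exists2 L, (0 < L)%N & forall x, J (x ^+ L.+1 - x).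
Proof.
move=> [Q [p [_ [kerp [I [F [f [_ [finj [L [L0 FL _]]]]]]]]]]].
have JP x : (forall i, f i (p x) = 0) -> J x.
  by move=> fx; apply/kerp/finj => i; rewrite fx rmorph0.
split; last split.
- split=> [|x y /kerp px /kerp py|r x /kerp px|x r /kerp px]; apply/kerp.
  + by rewrite rmorph0.
  + by rewrite rmorphB px py subrr.
  + by rewrite rmorphM px mulr0.
  + by rewrite rmorphM px mul0r.
- by move=> x y; apply: JP => i; rewrite !rmorphB !rmorphM mulrC subrr.
exists L => // x; apply: JP => i; rewrite !rmorphB !rmorphXn exprS.
have [->|y0] := eqVneq (f i (p x)) 0; first by rewrite mul0r subrr.
have /dvdnP[q ->] := FL i; rewrite mulnC exprM.
suff -> : f i (p x) ^+ (#|F i| - 1) = 1 by rewrite expr1n mulr1 subrr.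
apply: (mulfI y0); rewrite -exprS subn1 prednK ?expf_card ?mulr1 //.
by apply: ltnW; exact: finNzRing_gt1.
Qed.

Hypothesis Jnil : nil_bounded_index J.
Hypothesis Jlift : idempotents_lift_uniquely J.
Hypothesis Jideal : two_sided_ideal J.
Hypothesis Jcomm : forall x y, J (x * y - y * x).
Variable L : nat.
Hypothesis L_gt0 : (0 < L)%N.
Hypothesis JL : forall x, J (x ^+ L.+1 - x).

Lemma jacobson_opp_add :
  (forall x, J x -> J (- x)) /\ (forall x y, J x -> J y -> J (x + y)).
Proof. by case: Jideal => J0 JB _ _; exact: sub_closed_opp_add. Qed.

(** The idempotent [e + e * r * (1 - e)] is congruent to [e], the quotient being commutative. Unique
    lifting makes the second term zero, and likewise [(1 - e) * r * e]. *)
Lemma lift_abelian : abelian_ring R.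
Proof.
have [J0 JB Jl Jr] := Jideal; have [JN JD] := jacobson_opp_add.
have sq0 e x : idempotent e -> idempotent (e + x) -> J x -> x = 0.
  move=> ee ex Jx; have [|f [_ funiq]] := Jlift (a := e); first by rewrite ee subrr.
  apply: (addrI e); rewrite addr0 (funiq (e + x)) //; last by rewrite addrC addKr.
  by apply/esym/funiq; rewrite ?subrr.
have Je e r : idempotent e -> J (e * r * (1 - e)) /\ J ((1 - e) * r * e).
  move=> ee; split.
    have -> : e * r * (1 - e) = e * (r * (1 - e) - (1 - e) * r).
      by rewrite [RHS]mulrBr !mulrA [e * (1 - e)]mulrBr mulr1 ee subrr mul0r subr0.
    exact: Jl.
  have -> : (1 - e) * r * e = (1 - e) * (r * e - e * r).
    by rewrite [RHS]mulrBr !mulrA [(1 - e) * e]mulrBl mul1r ee subrr mul0r subr0.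
  exact: Jl.
move=> e ee r; have [Ju Jv] := Je e r ee.
have ne : e * (1 - e) = 0 by rewrite mulrBr mulr1 ee subrr.
have en : (1 - e) * e = 0 by rewrite mulrBl mul1r ee subrr.
have u0 : e * r * (1 - e) = 0.
  apply: (sq0 e) => //; set x := _ * _.
  have xe : x * e = 0 by rewrite /x -mulrA en mulr0.
  have ex : e * x = x by rewrite /x !mulrA ee.
  have xx : x * x = 0 by rewrite -{2}ex mulrA xe mul0r.
  by rewrite /idempotent mulrDl !mulrDr ee ex xe xx !addr0.
have v0 : (1 - e) * r * e = 0.
  apply: (sq0 e) => //; set x := _ * _.
  have ex : e * x = 0 by rewrite /x !mulrA ne !mul0r.
  have xe : x * e = x by rewrite /x -mulrA ee.
  have xx : x * x = 0 by rewrite -{1}xe -mulrA ex mulr0.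
  by rewrite /idempotent mulrDl !mulrDr ee ex xe xx !addr0.
have er : e * r = e * r * e.
  by apply/eqP; rewrite -subr_eq0 -{1}(mulr1 (e * r)) -mulrBr u0.
have -> : r * e = e * r * e; last exact: er.
by apply/eqP; rewrite -subr_eq0 -{1}(mul1r r) -!mulrBl v0.
Qed.

Lemma add1_jacobson_unit x : J (x - 1) -> x \is a GRing.unit.
Proof.
case: Jnil => k Jk; have [JN _] := jacobson_opp_add; rewrite -opprB => /JN.
rewrite opprK => /Jk /nilpotent_sub1_inv[z]; rewrite opprB addrC subrK => zx xz.
by apply/unitrP; exists z.
Qed.

(** Modulo [J], [r ^+ L] is idempotent; [e] is its lift and [1 - e] the idempotent part of [r]. The
    difference is a unit because it is one modulo the nil ideal [J]. *)
Lemma lift_clean : clean_ring R.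
Proof.
have [J0 JB Jl Jr] := Jideal; have [JN JD] := jacobson_opp_add.
move=> r; have [|e [[ee Jer] _]] := Jlift (a := r ^+ L).
  have -> : r ^+ L * r ^+ L - r ^+ L = r ^+ L.-1 * (r ^+ L.+1 - r).
    by rewrite mulrBr -!exprD -exprSr prednK // addnS -addSn prednK.
  exact: Jl.
exists (1 - e), (r - (1 - e)); split; last split.
- by rewrite /idempotent mulrBr mulr1 mulrBl mul1r ee subrr subr0.
- have ce x : e * x = x * e by exact: lift_abelian.
  (* An inverse modulo [J]: on the corner of [e], [r ^+ L] is congruent to the identity; on that of
     [1 - e], [r] is congruent to 0 and [r - 1] to -1. *)
  pose w := e * r ^+ L.-1 - (1 - e).
  have en : (1 - e) * e = 0 by rewrite mulrBl mul1r ee subrr.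
  have nn : (1 - e) * (1 - e) = 1 - e by rewrite mulrBr mulr1 en subr0.
  have c1e x : GRing.comm x (1 - e).
    by apply: commrB; [exact: commr1|exact/commr_sym/ce].
  have uwE : (r - (1 - e)) * w = e * r ^+ L - (1 - e) * r + (1 - e).
    rewrite /w; move: (1 - e) en nn (c1e r) => n en nn cn.
    rewrite mulrBl !mulrBr nn (mulrA n) en mul0r sub0r opprK -cn.
    by rewrite mulrA -ce -mulrA -exprS prednK.
  have cuw : GRing.comm (r - (1 - e)) w.
    apply: commrB; last exact: c1e.
    apply: commrM; first exact/commr_sym/ce.
    by apply/commrX/commr_sym/commrB; [|exact: c1e].
  have : (r - (1 - e)) * w \is a GRing.unit.
    apply: add1_jacobson_unit; rewrite uwE.
    have -> : e * r ^+ L - (1 - e) * r + (1 - e) - 1 =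
              - (e * (e - r ^+ L)) - ((r - r ^+ L.+1) - (e - r ^+ L) * r).
      rewrite -addrA [1 - e - 1]addrAC subrr add0r mulrBr ee opprB !mulrBl mul1r.
      have -> : r - r ^+ L.+1 - (e * r - r ^+ L * r) = r - e * r.
        by rewrite -exprSr opprD addrACA subrr addr0.
      by rewrite addrAC.
    apply: (JB _ _ (JN _ (Jl e _ Jer))); apply: (JB _ _ _ (Jr _ r Jer)).
    by rewrite -opprB; apply: (JN _ (JL r)).
  by rewrite unitrM_comm // => /andP[].
- by rewrite addrC subrK.
Qed.

(** Cancelling [u] puts [u ^+ L - 1] in [J], so [u ^+ L] is 1 plus a nilpotent of bounded index. *)
Lemma lift_units_exponent : finite_char R -> units_finite_exponent R.
Proof.
move=> [m [m0 mR]]; have [k Jk] := Jnil; have [_ _ Jl _] := Jideal.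
exists (L * (m * k`!))%N; rewrite !muln_gt0 L_gt0 m0 fact_gt0; split=> // u uU.
have /Jk juk : J (u ^+ L - 1).
  have -> : u ^+ L - 1 = u^-1 * (u ^+ L.+1 - u) by rewrite mulrBr exprS mulKr ?mulVr.
  exact: Jl.
by rewrite exprM -(subrK 1 (u ^+ L)) (exprD1_nilpotent mR juk).
Qed.

End LiftFromFields.

(** * Equivalence of the three conditions *)

Theorem theorem2p13 (R : unitRingType) :
  ((exists n : nat, n_torsion_clean R n /\ abelian_ring R) <->
   [/\ finite_char R, nil_bounded_index (@jacobson R),
       idempotents_lift_uniquely (@jacobson R) &
       quotient_subdirect_finite_fields_lcm (@jacobson R)]) /\
  ([/\ finite_char R, nil_bounded_index (@jacobson R),
       idempotents_lift_uniquely (@jacobson R) &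
       quotient_subdirect_finite_fields_lcm (@jacobson R)] <->
   (abelian_ring R /\ clean_ring R /\ units_finite_exponent R)).
Proof.
set A1 := (exists n, _); set A2 := [/\ _, _, _ & _]; set A3 := (_ /\ _ /\ _).
have A31 : A3 -> A1.
  move=> [Rab [Rcl [m [m0 Um]]]].
  (* The exponent [m] of the unit group satisfies [P]; the required [n] is the least such number and
     may be smaller than [m]. *)
  pose P n := (0 < n)%N && `[< torsion_clean_with R n >].
  have exP : exists n, P n.
    exists m; rewrite /P m0; apply/asboolP => r; have [e [u [ee [uU rE]]]] := Rcl r.
    by exists e, u; split=> //; apply: Um.
  case: (ex_minnP exP) => n /andP[n0 /asboolP Rn] nmin; exists n; split=> //.
  split=> //; split=> // l l0 Rl; apply: nmin; rewrite /P l0; exact/asboolP.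
have A12 : A1 -> A2.
  move=> [n [[n0 [Rn _]] Rab]]; have [k k0 Rk] := torsion_clean_periodic Rab n0 Rn.
  split.
  - exact: torsion_clean_finite_char Rab n0 Rn.
  - by exists k => r; exact: jacobson_nilpotent.
  - exact: periodic_idempotents_lift Rab k0 Rk.
  - exact: periodic_quotient Rab k0 Rk.
have A23 : A2 -> A3.
  move=> [Rchar Jnil Jlift /subdirect_jacobson[Jid [Jcomm [L L0 JL]]]].
  split; first exact: lift_abelian Jlift Jid Jcomm.
  split; first exact: (lift_clean Jnil Jlift Jid Jcomm L0 JL).
  exact: (lift_units_exponent Jnil Jid L0 JL).
by split; split=> // h; [apply/A31/A23|apply/A12/A31].
Qed.
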